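(* For positive integers $p,k,r$, \[ \sum_{j=1}^r\binom{p+r-j-1}{p-1}\eta(\{1\}_{j-1},k;p+r-j)=\sum_{j=1}^r\binom{k+r-j-1}{k-1}\eta(\{1\}_{j-1},p;k+r-j). \]
   Context: ${\rm Li}_{k_1,\ldots,k_r}(z)=\sum_{1\le n_1<\cdots<n_r}\frac{z^{n_r}}{n_1^{k_1}\cdots n_r^{k_r}}$ (for $z\le0$ understood via its analytic continuation / iterated integral representation). $\eta(k_1,\ldots,k_r;s)=\frac{1}{\Gamma(s)}\int_0^\infty\frac{t^{s-1}}{1-e^t}{\rm Li}_{k_1,\ldots,k_r}(1-e^t)\,dt$. $\{1\}_j$ denotes $j$ repetitions of $1$. *)

(* Defs.v *)
From Stdlib Require Import Reals List Lra Lia.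
From Coquelicot Require Import Coquelicot.
Open Scope R_scope.

(* Li_{k_1,...,k_r}(z) for real z < 1, as an iterated integral of the forms
   du/u and du/(1-u) from 0 to z.  The index is given in reverse order,
   k_r :: ... :: k_1 :: nil, since the innermost recursion peels off k_r:
     Li_{..., k_r}(z)          = int_0^z Li_{..., k_r - 1}(u) du/u      (k_r >= 2)
     Li_{k_1,..., k_(r-1), 1}(z) = int_0^z Li_{k_1,...,k_(r-1)}(u) du/(1-u)
   and Li of the empty index is 1.  For z < 0, [RInt _ 0 z] is the oriented
   integral; the value of [f u / u] at the endpoint u = 0 is irrelevant.
   Entries k = 0 are not meaningful (they are read as 1). *)
Fixpoint Li_rev (l : list nat) : R -> R :=
  match l with
  | nil => fun _ => 1
  | k :: l' =>
      Nat.iter (pred k) (fun f z => RInt (fun u => f u / u) 0 z)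
        (fun z => RInt (fun u => Li_rev l' u / (1 - u)) 0 z)
  end.

Definition Li (ks : list nat) (z : R) : R := Li_rev (rev ks) z.

(* Real parameter s > 0; [Rpower] is only evaluated at t > 0. *)
Definition Gamma (s : R) : R :=
  RInt_gen (fun t => Rpower t (s - 1) * exp (- t))
    (at_right 0) (Rbar_locally p_infty).

Definition eta (ks : list nat) (s : R) : R :=
  / Gamma s *
  RInt_gen (fun t => Rpower t (s - 1) / (1 - exp t) * Li ks (1 - exp t))
    (at_right 0) (Rbar_locally p_infty).

(* [Li] agrees with the multiple series on |z| < 1.  With the index reversed as
   above, the coefficient of z^n is
     sum_{1 <= n_1 < ... < n_r = n} 1 / (n_1^{k_1} ... n_r^{k_r}). *)
Fixpoint Li_coef (l : list nat) (n : nat) : R :=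
  match l with
  | nil => match n with O => 1 | S _ => 0 end
  | k :: l' =>
      match n with
      | O => 0
      | S m => sum_f_R0 (Li_coef l') m / INR n ^ k
      end
  end.

Lemma CV_radius_unit (a : nat -> R) :
  (forall z, Rabs z < 1 -> ex_pseries a z) ->
  forall z, Rabs z < 1 -> Rbar_lt (Rabs z) (CV_radius a).
Proof.
intros H z Hz.
set (w := (Rabs z + 1) / 2).
assert (Hz0 := Rabs_pos z).
assert (Hw : Rabs w = w) by (apply Rabs_pos_eq; unfold w; lra).
apply Rbar_lt_le_trans with w; [simpl; unfold w; lra|].
apply Rbar_not_lt_le; intros Hlt.
rewrite <- Hw in Hlt.
apply CV_disk_outside in Hlt; apply Hlt.
assert (Hs : ex_series (fun n => a n * w ^ n)).
{ apply ex_pseries_R, H. rewrite Hw; unfold w; lra. }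
now apply ex_series_lim_0 in Hs.
Qed.

Lemma is_pseries_ones z :
  Rabs z < 1 -> is_pseries (fun _ => 1) z (/ (1 - z)).
Proof.
intros Hz; apply is_pseries_R.
eapply is_series_ext; [|exact (is_series_geom z Hz)].
intros n; simpl; ring.
Qed.

Lemma between0_lt1 z u :
  Rabs z < 1 -> Rmin 0 z < u < Rmax 0 z -> u <> 0 /\ Rabs u < 1.
Proof.
intros Hz; unfold Rmin, Rmax; destruct (Rle_dec 0 z) as [H|H]; intros Hu.
- rewrite Rabs_pos_eq in Hz by lra; split; [lra|apply Rabs_def1; lra].
- rewrite Rabs_left in Hz by lra; split; [lra|apply Rabs_def1; lra].
Qed.

Lemma Li_rev_series (l : list nat) :
  List.Forall (fun k => (1 <= k)%nat) l ->
  forall z, Rabs z < 1 -> is_pseries (Li_coef l) z (Li_rev l z).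
Proof.
induction l as [|k l IH]; intros Hl.
- intros z _; apply is_pseries_R.
  apply is_series_Reals; intros e He; exists O; intros n _.
  replace (sum_f_R0 _ n) with 1.
  + rewrite R_dist_eq; exact He.
  + induction n as [|n IHn]; simpl in *; [ring|rewrite <- IHn; ring].
- inversion_clear Hl as [|? ? Hk Hl'].
  specialize (IH Hl').
  destruct k as [|k]; [lia|clear Hk].
  induction k as [|k IHk]; intros z Hz.
  + simpl Li_rev.
    set (b := PS_mult (Li_coef l) (fun _ => 1)).
    assert (Ha := CV_radius_unit _ (fun z Hz => ex_intro _ _ (IH z Hz))).
    assert (Ho := CV_radius_unit (fun _ => 1)
                    (fun z Hz => ex_intro _ _ (is_pseries_ones z Hz))).
    assert (Hb : forall z, Rabs z < 1 ->
               is_pseries b z (Li_rev l z * / (1 - z))).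
    { intros u Hu; apply is_pseries_mult; auto using is_pseries_ones. }
    rewrite (RInt_ext _ (PSeries b)).
    2: { intros u Hu; apply between0_lt1 in Hu; [|assumption].
         symmetry; apply is_pseries_unique, Hb, Hu. }
    apply is_pseries_ext with (PS_Int b).
    * intros [|n]; [reflexivity|].
      unfold PS_Int, Li_coef; fold Li_coef; rewrite pow_1; f_equal.
      apply sum_eq; intros; ring.
    * apply is_pseries_RInt, CV_radius_unit; [|assumption].
      intros u Hu; eexists; apply Hb, Hu.
  + set (f := Li_rev (S k :: l)) in *.
    change (Li_rev (S (S k) :: l) z) with (RInt (fun u => f u / u) 0 z).
    set (a := Li_coef (S k :: l)) in *.
    assert (Ha := CV_radius_unit _ (fun z Hz => ex_intro _ _ (IHk z Hz))).
    rewrite (RInt_ext _ (PSeries (PS_decr_1 a))).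
    2: { intros u Hu; apply between0_lt1 in Hu; [|assumption].
         destruct Hu as [Hu0 Hu1].
         rewrite <- (is_pseries_unique _ _ _ (IHk u Hu1)).
         change (PSeries a u / u = PSeries (PS_decr_1 a) u).
         rewrite PSeries_decr_1_aux by reflexivity.
         now field. }
    apply is_pseries_ext with (PS_Int (PS_decr_1 a)).
    * intros [|n]; [reflexivity|].
      unfold PS_Int, PS_decr_1, a, Li_coef; fold Li_coef.
      assert (INR (S n) <> 0) by (apply not_0_INR; lia).
      rewrite <- (tech_pow_Rmult (INR (S n)) (S k)).
      match goal with |- ?x = ?y => change (@eq R x y) end.
      field; split; try apply pow_nonzero; assumption.
    * apply is_pseries_RInt; rewrite CV_radius_decr_1; auto.
Qed.

Theorem Li_series (ks : list nat) (z : R) :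
  List.Forall (fun k => (1 <= k)%nat) ks -> Rabs z < 1 ->
  is_pseries (Li_coef (rev ks)) z (Li ks z).
Proof.
intros H; apply Li_rev_series.
now apply Forall_rev.
Qed.

(* Main.v *)
(* For n >= 0 and m >= 0 write L for Li of the index ({1}_n, m+1).  Along the
   curve z = (1 - e^t) e^(-s) the operator int du/u becomes integration in s, so
     L(1 - e^t) / (1 - e^t)
       = int_0^oo s^m/m! (s - ln E)^n/n! ds / E,      E = e^s + e^t - 1.
   Since Gamma is a factorial at positive integers, the binomial theorem applied
   to (t + s - ln E)^(r-1) turns the left-hand side of the theorem into
     int_0^oo int_0^oo t^(p-1)/(p-1)! s^(k-1)/(k-1)!
        (t + s - ln E)^(r-1)/(r-1)! ds dt / E,
   where E is symmetric in s and t.  Exchanging the integrals, which is allowed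
   because the integrand is O(e^(-t/4) e^(-s/4)), exchanges p and k. *)
Require Import Defs.
From Stdlib Require Import Reals List Lra Lia Factorial.
From Coquelicot Require Import Coquelicot.
Open Scope R_scope.

(** * Improper integrals over (0, oo) and Fubini on rectangles *)

(** The decay comes from two facts about [E]. Since [(e^s - 1)(e^t - 1) >= 0], both [s] and [t] are
    at most [ln E], which is at most [s + t]; so the bases [s - ln E] and [t + s - ln E] have
    absolute value at most [t]. Also [E >= e^(t/2) e^(s/2)]. Powers of [t] and [s] cost only a
    factor of order [e^(t/4) e^(s/4)]. Both ends of every integral are limits, since the integrands
    divide by [1 - e^t], which vanishes at [t = 0]. Continuity is therefore asked on the open
    quadrant only, and the exchange is made on squares [[a, b]^2] with an explicit estimate of the
    mass left outside. In the iterated integrals, [f u / u] is singular in form at [u = 0]. Each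
    polylogarithm is thus carried together with its zero and its differentiability there, which also
    makes the boundary terms at [s = oo] vanish. The single integral in [s] has a second use: it
    bounds the [eta] integrand in [t], so convergence needs no direct estimate of [Li] at large
    negative arguments. *)

Lemma filter_prod_0_oo (P : R * R -> Prop) (d M : R) :
  0 < d ->
  (forall a b, 0 < a < d -> M < b -> P (a, b)) ->
  filter_prod (at_right 0) (Rbar_locally p_infty) P.
Proof.
intros Hd HP.
apply Filter_prod with (fun a => 0 < a < d) (fun b => M < b).
- exists (mkposreal d Hd); intros a Ha Ha0.
  split; [assumption|].
  change (Rabs (a - 0) < d) in Ha; apply Rabs_def2 in Ha; lra.
- now exists M.
- auto.
Qed.

Lemma filter_prod_0_oo_ex (P : R * R -> Prop) :
  filter_prod (at_right 0) (Rbar_locally p_infty) P ->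
  forall d M, 0 < d -> exists a b, 0 < a < d /\ M < b /\ P (a, b).
Proof.
intros HP d M Hd.
assert (H : filter_prod (at_right 0) (Rbar_locally p_infty)
  (fun ab => 0 < fst ab < d /\ M < snd ab /\ P ab)).
{ assert (H0 := filter_prod_0_oo
    (fun ab => 0 < fst ab < d /\ M < snd ab) d M Hd).
  generalize (filter_and _ _ (H0 (fun a b Ha Hb => conj Ha Hb)) HP).
  apply filter_imp; tauto. }
destruct (filter_ex _ H) as [[a b] Hab]; exists a, b; auto.
Qed.

(** Only the open half-line enters, so [F] may be the primitive based at 1 of a function whose value
    at 0 is meaningless. *)
Lemma is_RInt_gen_0_oo_FTC (F f : R -> R) (la lb : R) :
  (forall t, 0 < t -> is_derive F t (f t)) ->
  (forall t, 0 < t -> continuous f t) ->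
  filterlim F (at_right 0) (locally la) ->
  filterlim F (Rbar_locally p_infty) (locally lb) ->
  is_RInt_gen f (at_right 0) (Rbar_locally p_infty) (lb - la).
Proof.
intros HF Hf Ha Hb.
apply (filterlimi_lim_ext_loc (fun ab => F (snd ab) - F (fst ab))).
- apply filter_prod_0_oo with 1 1; [lra|].
  intros a b Hab Hb1; apply (is_RInt_derive F f).
  + intros t Ht; apply HF; rewrite Rmin_left in Ht; simpl in *; lra.
  + intros t Ht; apply Hf; rewrite Rmin_left in Ht; simpl in *; lra.
- apply (filterlim_comp_2 (G := locally lb) (H := locally (- la))
    (fun ab => F (snd ab)) (fun ab => - F (fst ab)) Rplus).
  + eapply filterlim_comp; [apply filterlim_snd|exact Hb].
  + eapply filterlim_comp; [|apply (filterlim_opp (la : R_NormedModule))].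
    eapply filterlim_comp; [apply filterlim_fst|exact Ha].
  + apply (filterlim_plus (lb : R_NormedModule) (- la)).
Qed.

Lemma RInt_param_continuous (f : R -> R -> R) (c d x : R) :
  c <= d ->
  (forall y, c <= y <= d -> continuity_2d_pt f x y) ->
  locally x (fun x' => ex_RInt (f x') c d) ->
  continuous (fun x' => RInt (f x') c d) x.
Proof.
intros Hcd Hf Hex.
apply filterlim_locally; intros eps.
(* The [+ 1] keeps the denominator positive when [c = d] and makes the final inequality strict. *)
assert (He : 0 < eps / (d - c + 1)).
{ apply Rdiv_lt_0_compat; [apply cond_pos|lra]. }
destruct (uniform_continuity_2d_1d' f c d x Hf (mkposreal _ He)) as [delta Hd].
assert (Hx := locally_singleton _ _ Hex).
generalize (filter_and _ _ Hex (locally_ball x delta)).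
apply filter_imp; intros x' [Hx' Hb].
change (Rabs (x' - x) < delta) in Hb; apply Rabs_def2 in Hb.
change (Rabs (RInt (f x') c d - RInt (f x) c d) < eps).
assert (E : RInt (f x') c d - RInt (f x) c d
   = RInt (fun y => minus (f x' y) (f x y)) c d).
{ symmetry; exact (RInt_minus (f x') (f x) c d Hx' Hx). }
rewrite E.
apply Rle_lt_trans with ((d - c) * (eps / (d - c + 1))).
- apply abs_RInt_le_const; [assumption|now apply @ex_RInt_minus|].
  intros y Hy; apply Rlt_le.
  assert (Hp := cond_pos delta).
  apply (Hd y x y x'); try lra.
  replace (y - y) with 0 by ring; rewrite Rabs_R0; lra.
- replace (pos eps) with ((d - c + 1) * (eps / (d - c + 1))) at 2 by (field; lra).
  apply Rmult_lt_compat_r; lra.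
Qed.

Lemma continuity_2d_pt_swap (f : R -> R -> R) (x y : R) :
  continuity_2d_pt f x y -> continuity_2d_pt (fun s t => f t s) y x.
Proof.
intros H eps; destruct (H eps) as [d Hd].
exists d; intros u v Hu Hv; now apply Hd.
Qed.

Lemma continuity_2d_pt_continuous_r (f : R -> R -> R) (x y : R) :
  continuity_2d_pt f x y -> continuous (f x) y.
Proof.
intros H; apply filterlim_locally; intros eps.
destruct (H eps) as [d Hd].
exists d; intros v Hv.
apply (Hd x v); [|exact Hv].
replace (x - x) with 0 by ring; rewrite Rabs_R0; apply cond_pos.
Qed.

Lemma locally_pos (x : R) : 0 < x -> locally x (fun u => 0 < u).
Proof. apply (open_gt 0). Qed.

Lemma ex_RInt_quadrant_r (f : R -> R -> R) (x c d : R) :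
  (forall x y, 0 < x -> 0 < y -> continuity_2d_pt f x y) ->
  0 < x -> 0 < c -> 0 < d -> ex_RInt (f x) c d.
Proof.
intros f_cont Hx Hc Hd; apply (ex_RInt_continuous (V := R_CompleteNormedModule)).
intros z Hz; apply continuity_2d_pt_continuous_r, f_cont; [assumption|].
apply Rlt_le_trans with (2 := proj1 Hz); now apply Rmin_glb_lt.
Qed.

Lemma ex_RInt_quadrant_l (f : R -> R -> R) (y a b : R) :
  (forall x y, 0 < x -> 0 < y -> continuity_2d_pt f x y) ->
  0 < y -> 0 < a -> 0 < b -> ex_RInt (fun t => f t y) a b.
Proof.
intros f_cont Hy Ha Hb; apply (ex_RInt_continuous (V := R_CompleteNormedModule)).
intros z Hz; apply (continuity_2d_pt_continuous_r (fun s t => f t s)).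
apply continuity_2d_pt_swap, f_cont; [|assumption].
apply Rlt_le_trans with (2 := proj1 Hz); now apply Rmin_glb_lt.
Qed.

Lemma RInt_quadrant_continuous (f : R -> R -> R) (c d x : R) :
  (forall x y, 0 < x -> 0 < y -> continuity_2d_pt f x y) ->
  0 < c -> 0 < d -> 0 < x -> continuous (fun x' => RInt (f x') c d) x.
Proof.
intros f_cont.
assert (H : forall c d, 0 < c <= d -> 0 < x ->
  continuous (fun x' => RInt (f x') c d) x).
{ intros c' d' Hc Hx; apply RInt_param_continuous; [lra| |].
  - intros y Hy; apply f_cont; lra.
  - generalize (locally_pos x Hx); apply filter_imp.
    intros u Hu; apply ex_RInt_quadrant_r; auto; lra. }
intros Hc Hd Hx; destruct (Rle_lt_dec c d) as [Hcd|Hcd]; [apply H; lra|].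
apply continuous_ext_loc with (fun x' => opp (RInt (f x') d c)).
- generalize (locally_pos x Hx); apply filter_imp; intros u Hu.
  apply (opp_RInt_swap (f u) d c), ex_RInt_quadrant_r; auto; lra.
- apply (continuous_opp (fun x' => RInt (f x') d c)), H; lra.
Qed.

Lemma is_derive_RInt_quadrant (f : R -> R -> R) (a y x : R) :
  (forall x y, 0 < x -> 0 < y -> continuity_2d_pt f x y) ->
  0 < a -> 0 < y -> 0 < x ->
  is_derive (fun T => RInt (fun t => f t y) a T) x (f x y).
Proof.
intros f_cont Ha Hy Hx.
apply (is_derive_RInt (fun t => f t y) _ a).
- generalize (locally_pos x Hx); apply filter_imp.
  intros u Hu; apply (RInt_correct (V := R_CompleteNormedModule)).
  now apply ex_RInt_quadrant_l.
- apply (continuity_2d_pt_continuous_r (fun s t => f t s)).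
  now apply continuity_2d_pt_swap, f_cont.
Qed.

(** As functions of the upper bound [T] of the [t]-integral, both sides vanish at [T = a] and have
    derivative [RInt (f T) c d]; for the right-hand side this is differentiation under the integral
    sign. *)
Lemma RInt_fubini (f : R -> R -> R) (a b c d : R) :
  (forall x y, 0 < x -> 0 < y -> continuity_2d_pt f x y) ->
  0 < a <= b -> 0 < c <= d ->
  RInt (fun t => RInt (fun s => f t s) c d) a b
  = RInt (fun s => RInt (fun t => f t s) a b) c d.
Proof.
intros f_cont Hab Hcd.
set (Psi := fun T => RInt (fun s => RInt (fun t => f t s) a T) c d).
assert (HD : forall u v, 0 < u -> 0 < v ->
  Derive (fun z => RInt (fun t => f t v) a z) u = f u v).
{ intros u v Hu Hv; apply is_derive_unique, is_derive_RInt_quadrant; auto; lra. }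
assert (HPsi : forall T, 0 < T -> is_derive Psi T (RInt (f T) c d)).
{ intros T HT.
  rewrite (RInt_ext (f T) (fun s => Derive (fun z => RInt (fun t => f t s) a z) T)).
  2: { intros s Hs; rewrite Rmin_left in Hs by lra; symmetry; apply HD; lra. }
  apply (is_derive_RInt_param (fun T s => RInt (fun t => f t s) a T)).
  - generalize (locally_pos T HT); apply filter_imp; intros u Hu s Hs.
    rewrite Rmin_left in Hs by lra.
    exists (f u s); apply is_derive_RInt_quadrant; auto; lra.
  - intros s Hs; rewrite Rmin_left in Hs by lra.
    apply continuity_2d_pt_ext_loc with f; [|apply f_cont; lra].
    (* Within this radius both coordinates stay positive, so the partial derivative coincides with
       [f] on a whole neighbourhood and inherits its continuity. *)
    assert (Hm : 0 < Rmin T s) by (apply Rmin_glb_lt; lra).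
    exists (mkposreal _ Hm); simpl; intros u v Hu Hv.
    apply Rabs_def2 in Hu; apply Rabs_def2 in Hv.
    assert (H1 := Rmin_l T s); assert (H2 := Rmin_r T s).
    symmetry; apply HD; lra.
  - generalize (locally_pos T HT); apply filter_imp; intros u Hu.
    apply (ex_RInt_continuous (V := R_CompleteNormedModule)).
    intros s Hs; rewrite Rmin_left in Hs by lra.
    apply (RInt_quadrant_continuous (fun s t => f t s)); try lra.
    intros x y Hx Hy; now apply continuity_2d_pt_swap, f_cont. }
assert (H0 : Psi a = 0).
{ unfold Psi; rewrite (RInt_ext _ (fun _ => 0)).
  - rewrite RInt_const; apply Rmult_0_r.
  - intros s _; exact (RInt_point a (fun t => f t s)). }
apply is_RInt_unique.
replace (RInt (fun s => RInt (fun t => f t s) a b) c d) with (minus (Psi b) (Psi a)).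
2: { rewrite H0; apply Rminus_0_r. }
apply (is_RInt_derive Psi).
- intros t Ht; rewrite Rmin_left in Ht by lra; apply HPsi; lra.
- intros t Ht; rewrite Rmin_left in Ht by lra; apply RInt_quadrant_continuous; auto; lra.
Qed.

(** * Fubini under exponential domination *)

Lemma is_RInt_exp_bound (g : R -> R) (C c u v l : R) :
  0 < c -> u <= v ->
  (forall x, u <= x <= v -> Rabs (g x) <= C * exp (- c * x)) ->
  is_RInt g u v l ->
  Rabs l <= C / c * (exp (- c * u) - exp (- c * v)).
Proof.
intros Hc Huv Hg Hl.
apply (norm_RInt_le g (fun x => C * exp (- c * x)) u v l _ Huv Hg Hl).
replace (C / c * _) with
  (minus (- C / c * exp (- c * v)) (- C / c * exp (- c * u)))
  by (unfold minus, plus, opp; simpl; field; lra).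
apply (is_RInt_derive (fun x => - C / c * exp (- c * x))).
- intros x _; auto_derive; [trivial|field; lra].
- intros x _; apply (ex_derive_continuous (fun x => C * exp (- c * x))).
  auto_derive; trivial.
Qed.

Lemma ex_RInt_pos (g : R -> R) (a b : R) :
  (forall x, 0 < x -> continuous g x) -> 0 < a -> 0 < b -> ex_RInt g a b.
Proof.
intros Hg Ha Hb; apply (ex_RInt_continuous (V := R_CompleteNormedModule)).
intros x Hx; apply Hg.
apply Rlt_le_trans with (2 := proj1 Hx); now apply Rmin_glb_lt.
Qed.

Lemma is_derive_RInt_pos (g : R -> R) (a x : R) :
  (forall x, 0 < x -> continuous g x) -> 0 < a -> 0 < x ->
  is_derive (RInt g a) x (g x).
Proof.
intros Hg Ha Hx; apply (is_derive_RInt g _ a); [|now apply Hg].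
generalize (locally_pos x Hx); apply filter_imp; intros u Hu.
now apply (RInt_correct (V := R_CompleteNormedModule)), ex_RInt_pos.
Qed.

Lemma exp_le_compat (x y : R) : x <= y -> exp x <= exp y.
Proof.
intros [H| ->]; [now apply Rlt_le, exp_increasing|apply Rle_refl].
Qed.

Lemma RInt_exp_bound_pos (g : R -> R) (C c u v : R) :
  0 < c -> 0 < u -> 0 < v ->
  (forall x, 0 < x -> continuous g x) ->
  (forall x, 0 < x -> Rabs (g x) <= C * exp (- c * x)) ->
  Rabs (RInt g u v) <= C / c * Rabs (exp (- c * v) - exp (- c * u)).
Proof.
intros Hc.
assert (H : forall u v, 0 < u <= v ->
  (forall x, 0 < x -> continuous g x) ->
  (forall x, 0 < x -> Rabs (g x) <= C * exp (- c * x)) ->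
  Rabs (RInt g u v) <= C / c * Rabs (exp (- c * v) - exp (- c * u))).
{ intros u' v' Huv Hg HC.
  rewrite Rabs_minus_sym, (Rabs_pos_eq (exp _ - exp _)).
  2: { apply -> Rminus_le_0; apply exp_le_compat; nra. }
  apply (is_RInt_exp_bound g); [assumption|lra| |].
  - intros x Hx; apply HC; lra.
  - apply (RInt_correct (V := R_CompleteNormedModule)), ex_RInt_pos; auto; lra. }
intros Hu Hv Hg HC; destruct (Rle_lt_dec u v) as [Huv|Huv]; [apply H; auto; lra|].
replace (RInt g u v) with (- RInt g v u).
2: { apply (opp_RInt_swap g v u); apply ex_RInt_pos; auto. }
rewrite Rabs_Ropp, Rabs_minus_sym; apply H; auto; lra.
Qed.

Lemma exp_bound_nonneg (g : R -> R) (C c : R) :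
  (forall x, 0 < x -> Rabs (g x) <= C * exp (- c * x)) -> 0 <= C.
Proof.
intros HC; apply Rmult_le_reg_r with (exp (- c * 1)); [apply exp_pos|].
rewrite Rmult_0_l; apply Rle_trans with (2 := HC 1 Rlt_0_1), Rabs_pos.
Qed.

(** Cauchy criterion: increments of the primitive are at most [C / c] times increments of
    [exp (- c * x)], which converges along [F]. The filter is abstract so as to cover both ends, 0
    with [l = 1] and infinity with [l = 0]. *)
Lemma RInt_limit_exists (g : R -> R) (C c l : R)
  (F : (R -> Prop) -> Prop) {FF : ProperFilter F} :
  0 < c -> F (fun x => 0 < x) ->
  filterlim (fun x => exp (- c * x)) F (locally l) ->
  (forall x, 0 < x -> continuous g x) ->
  (forall x, 0 < x -> Rabs (g x) <= C * exp (- c * x)) ->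
  exists y, filterlim (RInt g 1) F (locally y).
Proof.
intros Hc Hpos Hl Hg HC.
apply (filterlim_locally_cauchy (U := R_CompleteSpace)); intros eps.
assert (HC0 := exp_bound_nonneg g C c HC).
assert (HCc : 0 <= C / c) by now apply Rdiv_le_0_compat.
(* Two points within [d] of [l] are less than [2 * d] apart; the [+ 1] covers [C = 0]. *)
assert (He : 0 < eps / (2 * (C / c + 1))).
{ apply Rdiv_lt_0_compat; [apply cond_pos|lra]. }
set (d := mkposreal _ He).
exists (fun x => 0 < x /\ ball l d (exp (- c * x))); split.
- apply filter_and; [assumption|].
  exact (proj1 (filterlim_locally _ _) Hl d).
- intros u v [Hu Bu] [Hv Bv].
  change (Rabs (RInt g 1 v - RInt g 1 u) < eps).
  assert (E : RInt g 1 v - RInt g 1 u = RInt g u v :> R).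
  { rewrite <- (RInt_Chasles g 1 u v (ex_RInt_pos g 1 u Hg Rlt_0_1 Hu)
      (ex_RInt_pos g u v Hg Hu Hv)).
    apply Rplus_minus_l. }
  rewrite E.
  apply Rle_lt_trans with (1 := RInt_exp_bound_pos g C c u v Hc Hu Hv Hg HC).
  change (Rabs (exp (- c * u) - l) < d) in Bu.
  change (Rabs (exp (- c * v) - l) < d) in Bv.
  apply Rle_lt_trans with (C / c * (2 * d)).
  + apply Rmult_le_compat_l; [assumption|].
    apply Rabs_def2 in Bu; apply Rabs_def2 in Bv.
    apply Rlt_le, Rabs_def1; lra.
  + assert (E2 : pos eps = (C / c + 1) * (2 * d)) by (simpl; field; nra).
    rewrite E2; apply Rmult_lt_compat_r; [|lra].
    assert (H := cond_pos d); lra.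
Qed.

Lemma at_right_pos : at_right 0 (fun x => 0 < x).
Proof. exists (mkposreal 1 Rlt_0_1); auto. Qed.

Lemma p_infty_pos : Rbar_locally p_infty (fun x => 0 < x).
Proof. now exists 0. Qed.

Lemma filterlim_at_right_continuous (g : R -> R) (x : R) :
  continuous g x -> filterlim g (at_right x) (locally (g x)).
Proof.
intros H; apply filterlim_filter_le_1 with (2 := H).
intros P [e He]; exists e; intros y Hy _; now apply He.
Qed.

Lemma filterlim_exp_neg (c : R) :
  0 < c -> filterlim (fun x => exp (- c * x)) (Rbar_locally p_infty) (locally 0).
Proof.
intros Hc.
apply (filterlim_comp _ _ _ (fun x => - c * x) exp _ (Rbar_locally m_infty)).
- intros P [M HM]; exists (- M / c); intros x Hx; apply HM.
  apply (Rmult_lt_compat_l c) in Hx; [|assumption].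
  replace (c * (- M / c)) with (- M) in Hx by (field; lra); lra.
- exact is_lim_exp_m.
Qed.

Lemma ex_RInt_gen_exp_bound (g : R -> R) (C c : R) :
  0 < c ->
  (forall x, 0 < x -> continuous g x) ->
  (forall x, 0 < x -> Rabs (g x) <= C * exp (- c * x)) ->
  exists l : R, is_RInt_gen g (at_right 0) (Rbar_locally p_infty) l.
Proof.
intros Hc Hg HC.
destruct (RInt_limit_exists g C c 1 (at_right 0)) as [la Hla]; auto.
- apply at_right_pos.
- replace 1 with (exp (- c * 0)) by (rewrite Rmult_0_r; apply exp_0).
  apply (filterlim_at_right_continuous (fun x => exp (- c * x))).
  apply (ex_derive_continuous (fun x => exp (- c * x))); auto_derive; trivial.
- destruct (RInt_limit_exists g C c 0 (Rbar_locally p_infty)) as [lb Hlb]; auto.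
  + apply p_infty_pos.
  + now apply filterlim_exp_neg.
  + exists (lb - la); apply is_RInt_gen_0_oo_FTC with (RInt g 1); auto.
    intros t Ht; apply is_derive_RInt_pos; auto; lra.
Qed.

(** The two exponential terms are the masses of the dominating function on [(0, a)] and [(b, oo)].
    The tails are estimated inside a larger interval [[a', b']] whose integral is within [eps] of
    [l]. With [a = b] the lemma bounds [l] itself. *)
Lemma RInt_gen_truncation (g : R -> R) (C c l a b : R) :
  0 < c -> 0 < a <= b ->
  (forall x, 0 < x -> continuous g x) ->
  (forall x, 0 < x -> Rabs (g x) <= C * exp (- c * x)) ->
  is_RInt_gen g (at_right 0) (Rbar_locally p_infty) l ->
  Rabs (l - RInt g a b) <= C / c * (1 - exp (- c * a) + exp (- c * b)).
Proof.
intros Hc Hab Hg HC Hl.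
apply le_epsilon; intros eps Heps.
assert (H := proj1 (filterlimi_locally _ _) Hl (mkposreal eps Heps)).
destruct (filter_prod_0_oo_ex _ H a b) as (a' & b' & Ha & Hb & y & Hy & Hly);
  [lra|simpl in Hy].
change (Rabs (y - l) < eps) in Hly.
assert (E : y = RInt g a' a + (RInt g a b + RInt g b b')).
{ rewrite <- (is_RInt_unique _ _ _ _ Hy).
  assert (E1 := RInt_Chasles g a b b'); unfold plus in E1; simpl in E1.
  assert (E2 := RInt_Chasles g a' a b'); unfold plus in E2; simpl in E2.
  rewrite E1, E2; [reflexivity|..]; apply ex_RInt_pos; auto; lra. }
assert (HC0 := exp_bound_nonneg g C c HC).
assert (HCc : 0 <= C / c) by now apply Rdiv_le_0_compat.
assert (B1 := RInt_exp_bound_pos g C c a' a Hc ltac:(lra) ltac:(lra) Hg HC).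
assert (B2 := RInt_exp_bound_pos g C c b b' Hc ltac:(lra) ltac:(lra) Hg HC).
assert (X1 : exp (- c * a) <= exp (- c * a')) by (apply exp_le_compat; nra).
assert (X2 : exp (- c * b') <= exp (- c * b)) by (apply exp_le_compat; nra).
assert (X3 : exp (- c * a') <= 1) by (rewrite <- exp_0; apply exp_le_compat; nra).
assert (X4 := exp_pos (- c * b')).
assert (Y1 : Rabs (exp (- c * a) - exp (- c * a')) <= 1 - exp (- c * a)).
{ rewrite Rabs_left1; lra. }
assert (Y2 : Rabs (exp (- c * b') - exp (- c * b)) <= exp (- c * b)).
{ rewrite Rabs_left1; lra. }
apply (Rmult_le_compat_l (C / c)) in Y1; [|assumption].
apply (Rmult_le_compat_l (C / c)) in Y2; [|assumption].
rewrite Rmult_plus_distr_l.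
replace (l - RInt g a b) with ((l - y) + (RInt g a' a + RInt g b b')) by (rewrite E; ring).
apply Rle_trans with (1 := Rabs_triang _ _).
assert (T := Rabs_triang (RInt g a' a) (RInt g b b')).
rewrite (Rabs_minus_sym l y); lra.
Qed.

(** One square [[a, b]^2] is chosen to serve both iterated integrals; on it the orders agree by
    [RInt_fubini], and each of [A] and [B] is close to the common value. *)
Lemma RInt_gen_fubini (f : R -> R -> R) (g h : R -> R) (C c A B : R) :
  0 < c ->
  (forall x y, 0 < x -> 0 < y -> continuity_2d_pt f x y) ->
  (forall x y, 0 < x -> 0 < y ->
    Rabs (f x y) <= C * exp (- c * x) * exp (- c * y)) ->
  (forall x, 0 < x ->
    is_RInt_gen (f x) (at_right 0) (Rbar_locally p_infty) (g x)) ->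
  (forall y, 0 < y ->
    is_RInt_gen (fun x => f x y) (at_right 0) (Rbar_locally p_infty) (h y)) ->
  is_RInt_gen g (at_right 0) (Rbar_locally p_infty) A ->
  is_RInt_gen h (at_right 0) (Rbar_locally p_infty) B ->
  A = B.
Proof.
intros Hc.
set (q := fun a b => 1 - exp (- c * a) + exp (- c * b)).
(* The square [[a, b]^2] misses mass [O(q a b)] of each iterated integral. *)
assert (Hsq : forall (f : R -> R -> R) (g : R -> R) (a b y : R),
  (forall x y, 0 < x -> 0 < y -> continuity_2d_pt f x y) ->
  (forall x y, 0 < x -> 0 < y ->
    Rabs (f x y) <= C * exp (- c * x) * exp (- c * y)) ->
  (forall x, 0 < x ->
    is_RInt_gen (f x) (at_right 0) (Rbar_locally p_infty) (g x)) ->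
  0 < a <= b -> is_RInt g a b y ->
  Rabs (y - RInt (fun x => RInt (f x) a b) a b) <= C / c / c * q a b).
{ intros f0 g0 a b y Hf HC Hg Hab Hy.
  assert (HC0 : 0 <= C / c).
  { apply Rdiv_le_0_compat; [|assumption].
    apply Rmult_le_reg_r with (exp (- c * 1) * exp (- c * 1)).
    - apply Rmult_lt_0_compat; apply exp_pos.
    - rewrite Rmult_0_l, <- Rmult_assoc.
      apply Rle_trans with (2 := HC 1 1 Rlt_0_1 Rlt_0_1), Rabs_pos. }
  assert (Hi : is_RInt (fun x => RInt (f0 x) a b) a b
                 (RInt (fun x => RInt (f0 x) a b) a b)).
  { apply (RInt_correct (V := R_CompleteNormedModule)).
    apply ex_RInt_pos; [|lra|lra].
    intros x Hx; apply RInt_quadrant_continuous; auto; lra. }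
  assert (Hq : 0 <= q a b).
  { unfold q; assert (H1 := exp_pos (- c * b)).
    assert (exp (- c * a) <= 1) by (rewrite <- exp_0; apply exp_le_compat; nra).
    lra. }
  assert (Hm := is_RInt_minus _ _ _ _ _ _ Hy Hi).
  assert (Hb : forall x, a <= x <= b ->
    Rabs (minus (g0 x) (RInt (f0 x) a b)) <= C / c * q a b * exp (- c * x)).
  { intros x Hx; assert (Hx0 : 0 < x) by lra.
    replace (C / c * q a b * exp (- c * x)) with (C * exp (- c * x) / c * q a b)
      by (field; lra).
    apply (RInt_gen_truncation (f0 x)); auto.
    intros z Hz; apply continuity_2d_pt_continuous_r; auto. }
  (* The truncation error at [x] still decays like [exp (- c * x)], so its integral stays bounded
     however large [b] is, at the price of a second factor [1 / c]. *)
  apply Rle_trans with (1 := is_RInt_exp_bound _ _ c a b _ Hc (proj2 Hab) Hb Hm).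
  replace (C / c / c * q a b) with (C / c * q a b / c * 1) by (field; lra).
  apply Rmult_le_compat_l.
  - apply Rdiv_le_0_compat; [|assumption]; now apply Rmult_le_pos.
  - assert (exp (- c * a) <= 1) by (rewrite <- exp_0; apply exp_le_compat; nra).
    assert (H1 := exp_pos (- c * b)); lra. }
intros Hf HC Hg Hh HA HB.
apply Rminus_diag_uniq, Rabs_eq_0, Rle_antisym; [|apply Rabs_pos].
set (K := Rabs (C / c / c)).
assert (HK : 0 <= K) by apply Rabs_pos.
apply le_epsilon; intros eps Heps; rewrite Rplus_0_l.
(* The budget is [e] for each of the two limits and [K * e] for each of the two truncations. *)
assert (He : 0 < eps / (2 + 2 * K)) by (apply Rdiv_lt_0_compat; lra).
set (e := mkposreal _ He).
assert (HA' := proj1 (filterlimi_locally _ _) HA e).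
assert (HB' := proj1 (filterlimi_locally _ _) HB e).
assert (e0 : 0 < e / 2) by (assert (H := cond_pos e); lra).
(* By [exp x >= 1 + x], the bound on [a] gives [1 - exp (- c * a) < e / 2] and the bound on [b]
   gives [exp (- c * b) <= e / 2]; the 1 in [Rmin] and [Rmax] ensures [a < b]. *)
destruct (filter_prod_0_oo_ex _ (filter_and _ _ HA' HB')
  (Rmin 1 (e / 2 / c)) (Rmax 1 (/ (c * (e / 2)))))
  as (a & b & Ha & Hb & (y1 & Hy1 & By1) & (y2 & Hy2 & By2)).
{ apply Rmin_glb_lt; [lra|now apply Rdiv_lt_0_compat]. }
simpl fst in *; simpl snd in *.
change (Rabs (y1 - A) < e) in By1; change (Rabs (y2 - B) < e) in By2.
assert (M1 := Rmin_l 1 (e / 2 / c)); assert (M2 := Rmin_r 1 (e / 2 / c)).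
assert (M3 := Rmax_l 1 (/ (c * (e / 2)))); assert (M4 := Rmax_r 1 (/ (c * (e / 2)))).
assert (Hq : 0 <= q a b <= e).
{ unfold q; split.
  - assert (H1 := exp_pos (- c * b)).
    assert (exp (- c * a) <= 1) by (rewrite <- exp_0; apply exp_le_compat; nra).
    lra.
  - assert (H1 := exp_ineq1_le (- c * a)).
    assert (H2 : c * a < e / 2).
    { replace (e / 2) with (c * (e / 2 / c)) by (field; lra).
      apply Rmult_lt_compat_l; lra. }
    assert (H3 : exp (- c * b) <= e / 2).
    { replace (- c * b) with (- (c * b)) by ring; rewrite exp_Ropp.
      replace (e / 2) with (/ / (e / 2)) by (apply Rinv_inv).
      apply Rinv_le_contravar; [now apply Rinv_0_lt_compat|].
      assert (H3 := exp_ineq1_le (c * b)).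
      replace (/ (e / 2)) with (c * / (c * (e / 2))) by (field; lra).
      apply Rle_trans with (c * b); [apply Rmult_le_compat_l|]; lra. }
    lra. }
assert (S1 := Hsq f g a b y1 Hf HC Hg ltac:(lra) Hy1).
assert (HC' : forall y x, 0 < y -> 0 < x ->
  Rabs (f x y) <= C * exp (- c * y) * exp (- c * x)).
{ intros y x Hy Hx; assert (H := HC x y Hx Hy); lra. }
assert (S2 := Hsq (fun y x => f x y) h a b y2
  (fun y x Hy Hx => continuity_2d_pt_swap f x y (Hf x y Hx Hy))
  HC' Hh ltac:(lra) Hy2).
cbv beta in S2; rewrite <- (RInt_fubini f a b a b Hf ltac:(lra) ltac:(lra)) in S2.
assert (HKq : C / c / c * q a b <= K * e).
{ apply Rle_trans with (K * q a b).
  - apply Rmult_le_compat_r; [lra|apply Rle_abs].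
  - apply Rmult_le_compat_l; lra. }
replace eps with (2 * e + 2 * (K * e)) by (simpl; field; lra).
set (J := RInt _ a b) in *.
replace (A - B) with (- (y1 - A) + ((y1 - J) + (- (y2 - J) + (y2 - B)))) by ring.
assert (T1 := Rabs_triang (- (y1 - A)) ((y1 - J) + (- (y2 - J) + (y2 - B)))).
assert (T2 := Rabs_triang (y1 - J) (- (y2 - J) + (y2 - B))).
assert (T3 := Rabs_triang (- (y2 - J)) (y2 - B)).
rewrite Rabs_Ropp in T1, T3; lra.
Qed.

(** * Polylogarithms along z = z0 exp (- s) *)

Lemma locally_neq (x y : R) : x <> y -> locally x (fun u => u <> y).
Proof.
intros Hxy; assert (Hd : 0 < Rabs (x - y)) by (apply Rabs_pos_lt; lra).
exists (mkposreal _ Hd); intros u Hu E; subst u.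
change (Rabs (y - x) < Rabs (x - y)) in Hu.
rewrite Rabs_minus_sym in Hu; lra.
Qed.

(** The singularity of [f z / z] at 0 is removable, with value the derivative of [f] at 0. *)
Lemma slope_extension (f : R -> R) :
  (forall z, z < 1 -> ex_derive f z) -> f 0 = 0 ->
  exists phi : R -> R,
    (forall z, z < 1 -> continuous phi z) /\
    (forall z, z <> 0 -> phi z = f z / z).
Proof.
intros Hf Hf0.
exists (fun u => if Req_EM_T u 0 then Derive f 0 else f u / u); split.
- intros z Hz; destruct (Req_dec z 0) as [->|Hz0].
  + unfold continuous; destruct (Req_EM_T 0 0) as [_|]; [|easy].
    assert (HD := Derive_correct f 0 (Hf 0 Hz)).
    apply is_derive_Reals in HD.
    apply filterlim_locally; intros eps.
    destruct (HD eps (cond_pos eps)) as [d Hd].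
    exists d; intros u Hu.
    change (Rabs ((if Req_EM_T u 0 then Derive f 0 else f u / u) - Derive f 0) < eps).
    destruct (Req_EM_T u 0) as [->|Hu0].
    * rewrite Rminus_diag, Rabs_R0; apply cond_pos.
    * change (Rabs (u - 0) < d) in Hu; rewrite Rminus_0_r in Hu.
      assert (H := Hd u Hu0 Hu).
      rewrite Rplus_0_l, Hf0, Rminus_0_r in H; exact H.
  + apply continuous_ext_loc with (fun u => f u / u).
    * generalize (locally_neq z 0 Hz0); apply filter_imp; intros u Hu.
      now destruct (Req_EM_T u 0).
    * apply (ex_derive_continuous (fun u => f u / u)).
      auto_derive; auto.
- intros z Hz; now destruct (Req_EM_T z 0).
Qed.

(** The integral from 0 to [z] never sees the endpoint 0, so the quotient may be replaced by its
    continuous extension. Differentiability at [z = 0] is included because the next iteration needs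
    it. *)
Lemma integral_slope (f : R -> R) :
  (forall z, z < 1 -> ex_derive f z) -> f 0 = 0 ->
  (forall z, z < 1 -> ex_derive (fun z => RInt (fun u => f u / u) 0 z) z) /\
  (forall z, z < 1 -> z <> 0 ->
     is_derive (fun z => RInt (fun u => f u / u) 0 z) z (f z / z)).
Proof.
intros Hf Hf0.
destruct (slope_extension f Hf Hf0) as (phi & Hc & Hphi).
assert (H : forall z, z < 1 ->
  is_derive (fun z => RInt (fun u => f u / u) 0 z) z (phi z)).
{ intros z Hz; apply is_derive_ext with (fun z => RInt phi 0 z).
  - intros t; apply RInt_ext; intros u Hu; apply Hphi; intros ->.
    unfold Rmin, Rmax in Hu; destruct (Rle_dec 0 t); lra.
  - apply (is_derive_RInt phi _ 0); [|now apply Hc].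
    generalize (open_lt 1 z Hz); apply filter_imp; intros u Hu.
    apply (RInt_correct (V := R_CompleteNormedModule)).
    apply (ex_RInt_continuous (V := R_CompleteNormedModule)).
    intros x Hx; apply Hc; apply Rle_lt_trans with (1 := proj2 Hx).
    apply Rmax_lub_lt; lra. }
split; intros z Hz.
- exists (phi z); now apply H.
- intros Hz0; rewrite <- Hphi by assumption; now apply H.
Qed.

Lemma is_derive_pow_fact (f : R -> R) (df x : R) (n : nat) :
  is_derive f x df ->
  is_derive (fun x => f x ^ S n / INR (fact (S n))) x (df * (f x ^ n / INR (fact n))).
Proof.
intros Hf.
apply (is_derive_comp (fun y => y ^ S n / INR (fact (S n))) f); [|assumption].
assert (Hn := INR_fact_neq_0 n).
assert (HSn : INR (S n) <> 0) by (apply not_0_INR; lia).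
evar_last.
- apply is_derive_ext with (fun y => / INR (fact (S n)) * y ^ S n).
  + intros y; apply Rmult_comm.
  + apply (is_derive_scal (fun y => y ^ S n)).
    apply (is_derive_pow (fun y => y) (S n) (f x) 1).
    apply (is_derive_id (K := R_AbsRing)).
- rewrite fact_simpl, mult_INR; simpl pred; field; auto.
Qed.

Lemma is_derive_pow_ln (n : nat) (z : R) :
  z < 1 ->
  is_derive (fun z => (- ln (1 - z)) ^ S n / INR (fact (S n))) z
    ((- ln (1 - z)) ^ n / INR (fact n) / (1 - z)).
Proof.
intros Hz; evar_last.
- apply (is_derive_pow_fact (fun z => - ln (1 - z)) (/ (1 - z))).
  auto_derive; [lra|field; lra].
- apply Rmult_comm.
Qed.

Lemma Li_rev_ones (n : nat) (z : R) :
  z < 1 -> Li_rev (repeat 1%nat n) z = (- ln (1 - z)) ^ n / INR (fact n).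
Proof.
revert z; induction n as [|n IH]; intros z Hz; [simpl; field|].
change (RInt (fun u => Li_rev (repeat 1%nat n) u / (1 - u)) 0 z
  = (- ln (1 - z)) ^ S n / INR (fact (S n))).
assert (Hm : forall u, u <= Rmax 0 z -> u < 1).
{ intros u Hu; apply Rle_lt_trans with (1 := Hu), Rmax_lub_lt; lra. }
rewrite (RInt_ext _ (fun u => (- ln (1 - u)) ^ n / INR (fact n) / (1 - u))).
2: { intros u Hu; rewrite IH; [reflexivity|apply Hm; lra]. }
apply is_RInt_unique.
assert (Hn := INR_fact_neq_0 n).
assert (HSn : INR (S n) <> 0) by (apply not_0_INR; lia).
(* The lower endpoint contributes [ln 1 = 0] to a positive power; it is written out to display a
   difference of antiderivative values. *)
replace ((- ln (1 - z)) ^ S n / INR (fact (S n))) with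
  (minus ((- ln (1 - z)) ^ S n / INR (fact (S n)))
         ((- ln (1 - 0)) ^ S n / INR (fact (S n)))).
2: { rewrite Rminus_0_r, ln_1, Ropp_0, pow_ne_zero by lia.
     unfold minus, plus, opp; simpl; field.
     apply INR_fact_neq_0 with (n := S n). }
apply (is_RInt_derive (fun u => (- ln (1 - u)) ^ S n / INR (fact (S n)))).
- intros u Hu; assert (Hu1 := Hm u (proj2 Hu)).
  now apply is_derive_pow_ln.
- intros u Hu; assert (Hu1 := Hm u (proj2 Hu)).
  apply (ex_derive_continuous (fun u => (- ln (1 - u)) ^ n / INR (fact n) / (1 - u))).
  auto_derive; repeat split; auto; lra.
Qed.

(** The index [({1}_n, m+1)], reversed. With this shift [m] counts the integrations against
    [du/u]. *)
Definition Li_ones (n m : nat) : R -> R := Li_rev (S m :: repeat 1%nat n).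

Lemma Li_ones_O (n : nat) (z : R) :
  z < 1 -> Li_ones n 0 z = (- ln (1 - z)) ^ S n / INR (fact (S n)).
Proof. apply (Li_rev_ones (S n)). Qed.

Lemma is_derive_Li_ones_O (n : nat) (z : R) :
  z < 1 ->
  is_derive (Li_ones n 0) z ((- ln (1 - z)) ^ n / INR (fact n) / (1 - z)).
Proof.
intros Hz.
apply is_derive_ext_loc with (fun u => (- ln (1 - u)) ^ S n / INR (fact (S n))).
- generalize (open_lt 1 z Hz); apply filter_imp; intros u Hu.
  symmetry; now apply Li_ones_O.
- now apply is_derive_pow_ln.
Qed.

(** The two properties go through the induction together: removing the singularity of the next
    integrand uses both. *)
Lemma Li_ones_regular (n m : nat) :
  Li_ones n m 0 = 0 /\ forall z, z < 1 -> ex_derive (Li_ones n m) z.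
Proof.
induction m as [|m [H0 HD]]; split.
- rewrite Li_ones_O, Rminus_0_r, ln_1, Ropp_0, pow_ne_zero by (lia || lra).
  apply Rmult_0_l.
- intros z Hz; eexists; now apply is_derive_Li_ones_O.
- exact (RInt_point 0 (fun u => Li_ones n m u / u)).
- exact (proj1 (integral_slope _ HD H0)).
Qed.

Lemma is_derive_Li_ones_S (n m : nat) (z : R) :
  z < 1 -> z <> 0 -> is_derive (Li_ones n (S m)) z (Li_ones n m z / z).
Proof.
destruct (Li_ones_regular n m) as [H0 HD].
exact (proj2 (integral_slope _ HD H0) z).
Qed.

(** * Powers against exponentials, and decay along the curve *)

Lemma pow_le_exp (i : nat) (x : R) :
  0 <= x -> x ^ i <= INR (fact i) * exp x.
Proof.
intros Hx.
apply Rle_trans with (INR (fact i) * (x ^ i / INR (fact i))).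
- apply Req_le; field; apply INR_fact_neq_0.
- apply Rmult_le_compat_l; [apply pos_INR|].
  apply Rle_trans with (2 := exp_ge_taylor x i Hx).
  assert (Hp : forall k, 0 <= x ^ k / INR (fact k)).
  { intros k; apply Rdiv_le_0_compat; [now apply pow_le|apply INR_fact_lt_0]. }
  destruct i as [|i]; [apply Rle_refl|].
  simpl sum_f_R0.
  assert (H := cond_pos_sum (fun k => x ^ k / INR (fact k)) i Hp).
  simpl in H |- *; lra.
Qed.

Lemma pow_le_exp_scaled (i : nat) (c x : R) :
  0 < c -> 0 <= x -> x ^ i <= INR (fact i) / c ^ i * exp (c * x).
Proof.
intros Hc Hx.
assert (Hci : 0 < c ^ i) by now apply pow_lt.
assert (H := pow_le_exp i (c * x) ltac:(apply Rmult_le_pos; lra)).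
rewrite Rpow_mult_distr in H.
apply Rmult_le_reg_l with (c ^ i); [assumption|].
replace (c ^ i * (INR (fact i) / c ^ i * exp (c * x)))
  with (INR (fact i) * exp (c * x)) by (field; lra).
exact H.
Qed.

Lemma filterlim_pow_exp_neg (i : nat) :
  filterlim (fun s => s ^ i * exp (- s)) (Rbar_locally p_infty) (locally 0).
Proof.
change (is_lim (fun s => s ^ i * exp (- s)) p_infty 0).
apply (is_lim_le_le_loc (fun _ => 0)
  (fun s => INR (fact i) / (/ 2) ^ i * exp (- (/ 2) * s))).
- exists 0; intros s Hs; split.
  + apply Rmult_le_pos; [apply pow_le; lra|apply Rlt_le, exp_pos].
  + assert (H := pow_le_exp_scaled i (/ 2) s ltac:(lra) ltac:(lra)).
    apply Rle_trans with (1 := Rmult_le_compat_r _ _ _ (Rlt_le _ _ (exp_pos (- s))) H).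
    rewrite Rmult_assoc, <- exp_plus; apply Req_le; do 2 f_equal; lra.
- apply is_lim_const.
- replace (Finite 0) with (Finite (INR (fact i) / (/ 2) ^ i * 0))
    by (f_equal; ring).
  apply (is_lim_scal_l (fun s => exp (- (/ 2) * s)) _ p_infty 0).
  apply (filterlim_exp_neg (/ 2)); lra.
Qed.

Lemma filterlim_exp_decay (z0 : R) :
  filterlim (fun s => z0 * exp (- s)) (Rbar_locally p_infty) (locally 0).
Proof.
replace 0 with (z0 * 0) by ring.
apply (filterlim_comp _ _ _ (fun s => exp (- s)) (fun x => z0 * x) _ (locally 0)).
- apply filterlim_ext with (fun s => exp (- (1) * s)).
  + intros s; f_equal; ring.
  + apply filterlim_exp_neg; lra.
- apply (filterlim_scal_r (K := R_AbsRing) (V := R_NormedModule) z0 0).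
Qed.

(** Writing [f z = z * phi z] with [phi] continuous at 0 extracts a factor [exp (- s)], which beats
    [s ^ i]. *)
Lemma filterlim_vanishing_times_pow (f : R -> R) (z0 : R) (i : nat) :
  z0 <> 0 -> (forall z, z < 1 -> ex_derive f z) -> f 0 = 0 ->
  filterlim (fun s => f (z0 * exp (- s)) * s ^ i) (Rbar_locally p_infty) (locally 0).
Proof.
intros Hz0 Hf Hf0.
destruct (slope_extension f Hf Hf0) as (phi & Hc & Hphi).
apply filterlim_ext with
  (fun s => phi (z0 * exp (- s)) * (z0 * (s ^ i * exp (- s)))).
- intros s; assert (He := exp_pos (- s)).
  assert (z0 * exp (- s) <> 0) by (apply Rmult_integral_contrapositive; lra).
  rewrite Hphi by assumption; field; split; lra.
- replace 0 with (phi 0 * (z0 * 0)) by ring.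
  apply (filterlim_comp_2 (G := locally (phi 0)) (H := locally (z0 * 0))
    (fun s => phi (z0 * exp (- s))) (fun s => z0 * (s ^ i * exp (- s))) Rmult).
  + eapply filterlim_comp; [apply filterlim_exp_decay|apply Hc; lra].
  + eapply filterlim_comp; [apply filterlim_pow_exp_neg|].
    apply (filterlim_scal_r (K := R_AbsRing) (V := R_NormedModule) z0 0).
  + apply (filterlim_mult (K := R_AbsRing) (phi 0) (z0 * 0)).
Qed.

(** Repeated integration by parts in closed form. Differentiating the term of index [i] gives [- M
    (m - i) s^i / i! + M (m + 1 - i) s^(i-1) / (i-1)!], whose second part cancels the first part of
    the preceding term; only the last one survives. *)
Lemma is_derive_sum_along_exp (M : nat -> R -> R) (z0 : R) (m n : nat) (s : R) :
  (forall k z, z < 0 -> is_derive (M (S k)) z (M k z / z)) ->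
  z0 < 0 -> (n <= m)%nat ->
  is_derive (fun s => sum_f_R0 (fun i => M (S m - i)%nat (z0 * exp (- s))
       * (s ^ i / INR (fact i))) n) s
    (- (M (m - n)%nat (z0 * exp (- s)) * (s ^ n / INR (fact n)))).
Proof.
intros HM Hz0.
assert (Hz : z0 * exp (- s) < 0) by (assert (H := exp_pos (- s)); nra).
assert (HMs : forall k, is_derive (fun s => M (S k) (z0 * exp (- s))) s
    (- M k (z0 * exp (- s)))).
{ intros k.
  replace (- M k (z0 * exp (- s))) with
    (scal (- (z0 * exp (- s))) (M k (z0 * exp (- s)) / (z0 * exp (- s)))).
  2: { unfold scal; simpl; unfold mult; simpl; field.
       split; [apply Rgt_not_eq, exp_pos|lra]. }
  apply (is_derive_comp (M (S k)) (fun s => z0 * exp (- s))); [now apply HM|].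
  auto_derive; [trivial|ring]. }
induction n as [|n IH]; intros Hn.
- simpl sum_f_R0; rewrite !Nat.sub_0_r.
  apply is_derive_ext with (fun s => M (S m) (z0 * exp (- s))).
  + intros u; simpl; field.
  + replace (- _) with (- M m (z0 * exp (- s))) by (simpl; field).
    apply HMs.
- cbn [sum_f_R0].
  replace (m - n)%nat with (S (m - S n)) in IH by lia.
  replace (S m - S n)%nat with (S (m - S n)) by lia.
  set (k := (m - S n)%nat) in *.
  replace (- (M k (z0 * exp (- s)) * (s ^ S n / INR (fact (S n))))) with
    (plus (- (M (S k) (z0 * exp (- s)) * (s ^ n / INR (fact n))))
      (plus (mult (- M k (z0 * exp (- s))) (s ^ S n / INR (fact (S n))))
        (mult (M (S k) (z0 * exp (- s))) (s ^ n / INR (fact n))))).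
  2: { unfold plus, mult; simpl plus; simpl mult; simpl; ring. }
  apply (is_derive_plus (K := R_AbsRing) (V := R_NormedModule)); [apply IH; lia|].
  apply (is_derive_mult (K := R_AbsRing) (fun s => M (S k) (z0 * exp (- s)))
    (fun s => s ^ S n / INR (fact (S n)))); [apply HMs| |apply Rmult_comm].
  evar_last; [apply (is_derive_pow_fact (fun s => s)), (is_derive_id (K := R_AbsRing))|].
  apply Rmult_1_l.
Qed.

(* Along [z = z0 e^(-s)] one has [d/ds M (k+1) = - M k], so an [(m+1)]-fold
   iterated integral collapses to a single one with weight [s^m / m!]. *)
Lemma iterated_integral_along_exp (M : nat -> R -> R) (z0 : R) (m : nat) :
  (forall z, z < 0 -> continuous (M 0%nat) z) ->
  (forall k z, z < 0 -> is_derive (M (S k)) z (M k z / z)) ->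
  (forall k z, z < 1 -> ex_derive (M (S k)) z) ->
  (forall k, M (S k) 0 = 0) ->
  z0 < 0 ->
  is_RInt_gen (fun s => s ^ m / INR (fact m) * M 0%nat (z0 * exp (- s)))
    (at_right 0) (Rbar_locally p_infty) (M (S m) z0).
Proof.
intros HM0 HM HMd HMz Hz0.
(* [- P m] is the antiderivative. At [s = 0] only the term [i = 0] remains, with value [M (S m) z0].
   At infinity all terms vanish: [i <= m] keeps the index of [M] at least 1, and nothing is asked of
   [M 0] at the origin. *)
set (P := fun n s => sum_f_R0 (fun i => M (S m - i)%nat (z0 * exp (- s))
       * (s ^ i / INR (fact i))) n).
assert (HP : forall s, is_derive (P m) s
  (- (s ^ m / INR (fact m) * M 0%nat (z0 * exp (- s))))).
{ intros s; rewrite (Rmult_comm (s ^ m / _)), <- (Nat.sub_diag m) at 1.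
  now apply is_derive_sum_along_exp. }
replace (M (S m) z0) with (0 - - M (S m) z0) by ring.
apply is_RInt_gen_0_oo_FTC with (fun s => - P m s).
- intros s _.
  rewrite <- (Ropp_involutive (s ^ m / _ * _)).
  exact (is_derive_opp (V := R_NormedModule) _ _ _ (HP s)).
- intros s _.
  apply (continuous_mult (K := R_AbsRing) (fun s => s ^ m / INR (fact m))).
  + apply (ex_derive_continuous (fun s => s ^ m / INR (fact m))).
    auto_derive; trivial.
  + apply (continuous_comp (fun s => z0 * exp (- s)) (M 0%nat)).
    * apply (ex_derive_continuous (fun s => z0 * exp (- s))); auto_derive; trivial.
    * apply HM0; assert (H := exp_pos (- s)); nra.
- replace (- M (S m) z0) with (- P m 0).
  + apply (filterlim_at_right_continuous (fun s => - P m s)).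
    apply (continuous_opp (K := R_AbsRing) (V := R_NormedModule) (P m)).
    apply (ex_derive_continuous (P m)).
    eexists; apply HP.
  + f_equal; unfold P; clear.
    assert (H : forall n, sum_f_R0 (fun i => M (S m - i)%nat (z0 * exp (- 0))
       * (0 ^ i / INR (fact i))) n = M (S m) z0); [|apply H].
    induction n as [|n IH].
    * cbn [sum_f_R0]; rewrite Nat.sub_0_r, Ropp_0, exp_0, Rmult_1_r; simpl; field.
    * cbn [sum_f_R0]; rewrite IH, pow_ne_zero by lia.
      unfold Rdiv; ring.
- replace 0 with (- 0) by ring.
  eapply filterlim_comp; [|apply (filterlim_opp (0 : R_NormedModule))].
  assert (H : forall n, (n <= m)%nat ->
    filterlim (P n) (Rbar_locally p_infty) (locally 0)); [|now apply H].
  assert (Ht : forall i, (i <= m)%nat ->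
    filterlim (fun s => M (S m - i)%nat (z0 * exp (- s)) * (s ^ i / INR (fact i)))
      (Rbar_locally p_infty) (locally 0)).
  { intros i Hi; replace (S m - i)%nat with (S (m - i)) by lia.
    apply filterlim_ext with
      (fun s => / INR (fact i) * (M (S (m - i)) (z0 * exp (- s)) * s ^ i)).
    { intros s; unfold Rdiv; ring. }
    replace 0 with (/ INR (fact i) * 0) by ring.
    eapply filterlim_comp.
    - apply filterlim_vanishing_times_pow; [lra|apply HMd|apply HMz].
    - apply (filterlim_scal_r (K := R_AbsRing) (V := R_NormedModule) _ 0). }
  induction n as [|n IH]; intros Hn; [apply (Ht O Hn)|].
  replace 0 with (0 + 0) by ring.
  apply (filterlim_comp_2 (G := locally 0) (H := locally 0) (P n) _ Rplus).
  + apply IH; lia.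
  + apply Ht, Hn.
  + apply (filterlim_plus (0 : R_NormedModule) 0).
Qed.

Lemma Li_ones_integral (n m : nat) (t : R) :
  0 < t ->
  is_RInt_gen (fun s => s ^ m / INR (fact m)
      * ((s - ln (exp s + exp t - 1)) ^ n / INR (fact n)) / (exp s + exp t - 1))
    (at_right 0) (Rbar_locally p_infty)
    (Li_ones n m (1 - exp t) / (1 - exp t)).
Proof.
intros Ht.
assert (Het : 1 < exp t) by (rewrite <- exp_0; now apply exp_increasing).
(* The bottom of the chain is [z] times the derivative of [Li_ones n 0], so that dividing by [z]
   recovers that derivative and every step has the form [du/u]. *)
set (M := fun k => match k with
  | O => fun z => (- ln (1 - z)) ^ n / INR (fact n) / (1 - z) * z
  | S k => Li_ones n k
  end).
assert (HM := iterated_integral_along_exp M (1 - exp t) m).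
apply (is_RInt_gen_ext (fun s => scal (/ (1 - exp t))
  (s ^ m / INR (fact m) * M 0%nat ((1 - exp t) * exp (- s))))).
- apply filter_prod_0_oo with 1 1; [lra|]; intros a b Ha Hb s Hs.
  simpl in Hs; rewrite Rmin_left in Hs by lra.
  assert (Hes : 1 < exp s) by (rewrite <- exp_0; apply exp_increasing; lra).
  unfold M.
  (* With [E = exp s + exp t - 1] this reads [1 - z = E exp (- s)]; hence [- ln (1 - z) = s - ln E]
     and [z / (1 - z) = (1 - exp t) / E]. *)
  replace (1 - (1 - exp t) * exp (- s)) with ((exp s + exp t - 1) * exp (- s)).
  2: { rewrite exp_Ropp; field; lra. }
  rewrite ln_mult, ln_exp by (try apply exp_pos; lra).
  replace (- (ln (exp s + exp t - 1) + - s)) with (s - ln (exp s + exp t - 1)) by ring.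
  unfold scal; simpl; unfold mult; simpl.
  assert (Hn := INR_fact_neq_0 n); assert (Hm := INR_fact_neq_0 m).
  assert (He := exp_pos (- s)).
  field; repeat split; lra.
- unfold Rdiv; rewrite (Rmult_comm (Li_ones n m (1 - exp t))).
  apply (is_RInt_gen_scal (V := R_NormedModule)).
  apply HM.
  + intros z Hz; apply (ex_derive_continuous (M 0%nat)); unfold M.
    auto_derive; repeat split; lra.
  + intros [|k] z Hz.
    * replace (M 0%nat z / z) with ((- ln (1 - z)) ^ n / INR (fact n) / (1 - z)).
      { apply is_derive_Li_ones_O; lra. }
      unfold M; assert (Hn := INR_fact_neq_0 n); field; repeat split; lra.
    * apply is_derive_Li_ones_S; lra.
  + intros k; apply Li_ones_regular.
  + intros k; apply Li_ones_regular.
  + lra.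
Qed.

(** * The symmetric double integral *)

Lemma is_RInt_gen_0_oo_ext (f g : R -> R) (l : R) :
  (forall x, 0 < x -> f x = g x) ->
  is_RInt_gen f (at_right 0) (Rbar_locally p_infty) l ->
  is_RInt_gen g (at_right 0) (Rbar_locally p_infty) l.
Proof.
intros Hfg; apply is_RInt_gen_ext.
apply filter_prod_0_oo with 1 1; [lra|]; intros a b Ha Hb x Hx.
simpl in Hx; rewrite Rmin_left in Hx by lra; apply Hfg; lra.
Qed.

Lemma is_RInt_gen_sum_f_R0 (f : nat -> R -> R) (l : nat -> R) (n : nat) :
  (forall i, (i <= n)%nat ->
    is_RInt_gen (f i) (at_right 0) (Rbar_locally p_infty) (l i)) ->
  is_RInt_gen (fun x => sum_f_R0 (fun i => f i x) n)
    (at_right 0) (Rbar_locally p_infty) (sum_f_R0 l n).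
Proof.
induction n as [|n IH]; intros H; [apply H; lia|].
cbn [sum_f_R0].
apply (is_RInt_gen_plus (V := R_NormedModule) (fun x => sum_f_R0 (fun i => f i x) n)).
- apply IH; auto.
- now apply H.
Qed.

(* [M k z = z] for all [k] is an admissible chain of iterated integrals. *)
Lemma is_RInt_gen_pow_exp (n : nat) :
  is_RInt_gen (fun t => t ^ n * exp (- t)) (at_right 0) (Rbar_locally p_infty)
    (INR (fact n)).
Proof.
(* The start of the curve must be negative; [-1] is undone by the scalar [- INR (fact n)]. *)
assert (H := iterated_integral_along_exp (fun _ z => z) (-1) n).
apply is_RInt_gen_0_oo_ext with (fun t => scal (- INR (fact n))
  (t ^ n / INR (fact n) * (-1 * exp (- t)))).
- intros t Ht; unfold scal; simpl; unfold mult; simpl.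
  field; apply INR_fact_neq_0.
- evar_last; [apply (is_RInt_gen_scal (V := R_NormedModule)), H|].
  + intros z _; apply continuous_id.
  + intros k z Hz; replace (z / z) with 1 by (field; lra).
    apply (is_derive_id (K := R_AbsRing)).
  + intros k z _; apply (ex_derive_id (K := R_AbsRing)).
  + reflexivity.
  + lra.
  + unfold scal; simpl; unfold mult; simpl; ring.
Qed.

Lemma Rpower_INR_S (n : nat) (t : R) :
  0 < t -> Rpower t (INR (S n) - 1) = t ^ n.
Proof.
intros Ht; rewrite <- Rpower_pow by assumption; f_equal.
rewrite S_INR; ring.
Qed.

Lemma RInt_gen_0_oo_unique (f : R -> R) (l : R) :
  is_RInt_gen f (at_right 0) (Rbar_locally p_infty) l ->
  RInt_gen f (at_right 0) (Rbar_locally p_infty) = l.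
Proof.
apply (is_RInt_gen_unique (V := R_CompleteNormedModule)).
Qed.

Lemma Gamma_S (n : nat) : Gamma (INR (S n)) = INR (fact n).
Proof.
unfold Gamma; apply RInt_gen_0_oo_unique.
apply is_RInt_gen_0_oo_ext with (2 := is_RInt_gen_pow_exp n).
intros t Ht; now rewrite Rpower_INR_S.
Qed.

(** * Exponential bounds and convergence of the eta integrals *)

Lemma exp_gt_1 (x : R) : 0 < x -> 1 < exp x.
Proof. intros Hx; rewrite <- exp_0; now apply exp_increasing. Qed.

Lemma ln_exp_plus_exp_bounds (t s : R) :
  0 < t -> 0 < s ->
  s <= ln (exp s + exp t - 1) <= s + t.
Proof.
intros Ht Hs.
assert (H1 := exp_gt_1 t Ht); assert (H2 := exp_gt_1 s Hs); split.
- rewrite <- (ln_exp s) at 1; apply ln_le; [apply exp_pos|lra].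
- rewrite <- (ln_exp (s + t)), exp_plus; apply ln_le; nra.
Qed.

(** With [x = exp (t/2)] and [y = exp (s/2)], both above 1, the difference of the two sides is
    [(x - y)^2 + (x y - 1)]. *)
Lemma exp_half_sum_le (t s : R) :
  0 < t -> 0 < s -> exp (/ 2 * t) * exp (/ 2 * s) <= exp s + exp t - 1.
Proof.
intros Ht Hs.
assert (H1 := exp_gt_1 (/ 2 * t) ltac:(lra)).
assert (H2 := exp_gt_1 (/ 2 * s) ltac:(lra)).
replace s with (/ 2 * s + / 2 * s) at 2 by field.
replace t with (/ 2 * t + / 2 * t) at 2 by field.
rewrite !exp_plus; nra.
Qed.

(** [y] is left free to serve both for [s - ln E] and for [t + s - ln E]. Its power is absorbed into
    [t ^ (N + n)]; the rate [1/4] is what remains of the rate [1/2] of [1 / E] after the powers have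
    used [1/4]. *)
Lemma kernel_bound (N m n : nat) :
  exists C, forall t s y, 0 < t -> 0 < s -> Rabs y <= t ->
  Rabs (t ^ N * s ^ m * y ^ n / (exp s + exp t - 1))
    <= C * exp (- / 4 * t) * exp (- / 4 * s).
Proof.
set (A := INR (fact (N + n)) / (/ 4) ^ (N + n)).
set (B := INR (fact m) / (/ 4) ^ m).
exists (A * B); intros t s y Ht Hs Hy.
assert (HE := exp_half_sum_le t s Ht Hs).
assert (HE0 : 0 < exp (/ 2 * t) * exp (/ 2 * s))
  by (apply Rmult_lt_0_compat; apply exp_pos).
assert (HA := pow_le_exp_scaled (N + n) (/ 4) t ltac:(lra) ltac:(lra)).
assert (HB := pow_le_exp_scaled m (/ 4) s ltac:(lra) ltac:(lra)).
fold A in HA; fold B in HB.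
unfold Rdiv; rewrite !Rabs_mult, Rabs_inv, <- !RPow_abs.
rewrite (Rabs_pos_eq t), (Rabs_pos_eq s), (Rabs_pos_eq (exp s + exp t - 1)) by lra.
replace (A * B * exp (- / 4 * t) * exp (- / 4 * s)) with
  ((A * exp (/ 4 * t)) * (B * exp (/ 4 * s)) * / (exp (/ 2 * t) * exp (/ 2 * s))).
2: { replace (/ 2 * t) with (/ 4 * t + / 4 * t) by field.
     replace (/ 2 * s) with (/ 4 * s + / 4 * s) by field.
     replace (- / 4 * t) with (- (/ 4 * t)) by ring.
     replace (- / 4 * s) with (- (/ 4 * s)) by ring.
     rewrite !exp_plus, !exp_Ropp; field; split; apply Rgt_not_eq, exp_pos. }
assert (P1 : 0 <= t ^ N) by (apply pow_le; lra).
assert (P2 : 0 <= s ^ m) by (apply pow_le; lra).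
assert (P3 : 0 <= Rabs y ^ n) by (apply pow_le, Rabs_pos).
apply Rmult_le_compat.
- now repeat apply Rmult_le_pos.
- apply Rlt_le, Rinv_0_lt_compat; lra.
- apply Rle_trans with (t ^ (N + n) * s ^ m).
  + rewrite pow_add.
    replace (t ^ N * t ^ n * s ^ m) with (t ^ N * s ^ m * t ^ n) by ring.
    apply Rmult_le_compat_l; [now apply Rmult_le_pos|].
    apply pow_incr; split; [apply Rabs_pos|assumption].
  + apply Rmult_le_compat; auto; apply pow_le; lra.
- now apply Rinv_le_contravar.
Qed.

Lemma continuous_kernel_r (N m n : nat) (t s : R) :
  0 < t -> 0 < s ->
  continuous (fun s => t ^ N * s ^ m * (s - ln (exp s + exp t - 1)) ^ n
    / (exp s + exp t - 1)) s.
Proof.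
intros Ht Hs; assert (H1 := exp_gt_1 t Ht); assert (H2 := exp_gt_1 s Hs).
apply (ex_derive_continuous (fun s => t ^ N * s ^ m
  * (s - ln (exp s + exp t - 1)) ^ n / (exp s + exp t - 1))).
auto_derive; repeat split; lra.
Qed.

(** The integrand of [Gamma (N+1) * eta ({1}_n, m+1; N+1)], with a natural power in place of
    [Rpower]. *)
Definition eta_integrand (N n m : nat) (t : R) : R :=
  t ^ N / (1 - exp t) * Li_ones n m (1 - exp t).

Lemma eta_integrand_integral (N n m : nat) (t : R) :
  0 < t ->
  is_RInt_gen (fun s => / (INR (fact m) * INR (fact n)) * (t ^ N * s ^ m
      * (s - ln (exp s + exp t - 1)) ^ n / (exp s + exp t - 1)))
    (at_right 0) (Rbar_locally p_infty) (eta_integrand N n m t).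
Proof.
intros Ht; unfold eta_integrand.
assert (H := is_RInt_gen_scal (V := R_NormedModule) _ (t ^ N) _ (Li_ones_integral n m t Ht)).
replace (t ^ N / (1 - exp t) * Li_ones n m (1 - exp t))
  with (scal (t ^ N) (Li_ones n m (1 - exp t) / (1 - exp t))).
2: { unfold scal; simpl; unfold mult, Rdiv; simpl; ring. }
apply is_RInt_gen_0_oo_ext with (2 := H); intros s Hs.
assert (H1 := exp_gt_1 t Ht); assert (H2 := exp_gt_1 s Hs).
assert (Hn := INR_fact_neq_0 n); assert (Hm := INR_fact_neq_0 m).
unfold scal; simpl; unfold mult; simpl; field; repeat split; lra.
Qed.

Lemma eta_integrand_bound (N n m : nat) :
  exists C, forall t, 0 < t -> Rabs (eta_integrand N n m t) <= C * exp (- / 4 * t).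
Proof.
destruct (kernel_bound N m n) as [C HC].
set (K := / (INR (fact m) * INR (fact n))).
exists (K * C / / 4); intros t Ht.
assert (HK : 0 <= K).
{ apply Rlt_le, Rinv_0_lt_compat, Rmult_lt_0_compat; apply INR_fact_lt_0. }
assert (Hc : forall s, 0 < s -> continuous (fun s => K * (t ^ N * s ^ m
    * (s - ln (exp s + exp t - 1)) ^ n / (exp s + exp t - 1))) s).
{ intros s Hs; apply (continuous_mult (K := R_AbsRing) (fun _ => K)).
  - apply continuous_const.
  - now apply continuous_kernel_r. }
(* On the degenerate interval [[1, 1]] the integral is 0 and the two exponentials cancel, so the
   truncation error is a bound for the whole integral in [s]. *)
assert (H := fun l => RInt_gen_truncation _ (K * C * exp (- / 4 * t)) (/ 4) l 1 1
  ltac:(lra) ltac:(lra) Hc).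
specialize (H (eta_integrand N n m t)).
rewrite RInt_point in H.
change (@zero R_CompleteNormedModule) with 0 in H.
replace (K * C / / 4 * exp (- / 4 * t)) with
  (K * C * exp (- / 4 * t) / / 4 * (1 - exp (- / 4 * 1) + exp (- / 4 * 1))) by field.
rewrite <- (Rminus_0_r (eta_integrand N n m t)); apply H.
- intros s Hs; rewrite Rabs_mult, (Rabs_pos_eq K) by assumption.
  rewrite !Rmult_assoc; apply Rmult_le_compat_l; [assumption|].
  rewrite <- !Rmult_assoc; apply HC; auto.
  assert (B := ln_exp_plus_exp_bounds t s Ht Hs).
  rewrite Rabs_left1; lra.
- now apply eta_integrand_integral.
Qed.

Lemma eta_integrand_continuous (N n m : nat) (t : R) :
  0 < t -> continuous (eta_integrand N n m) t.
Proof.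
intros Ht; assert (H1 := exp_gt_1 t Ht).
apply (continuous_mult (K := R_AbsRing) (fun t => t ^ N / (1 - exp t))
  (fun t => Li_ones n m (1 - exp t))).
- apply (ex_derive_continuous (fun t => t ^ N / (1 - exp t))).
  auto_derive; lra.
- apply (continuous_comp (fun t => 1 - exp t) (Li_ones n m)).
  + apply (ex_derive_continuous (fun t => 1 - exp t)); auto_derive; trivial.
  + apply (ex_derive_continuous (Li_ones n m)), Li_ones_regular; lra.
Qed.

(** [eta] is defined by [RInt_gen], which determines a value only when the integral converges;
    existence therefore comes first, then uniqueness identifies the value. *)
Lemma is_RInt_gen_eta (N n m : nat) :
  is_RInt_gen (eta_integrand N n m) (at_right 0) (Rbar_locally p_infty)
    (INR (fact N) * eta (repeat 1%nat n ++ S m :: nil) (INR (S N))).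
Proof.
destruct (eta_integrand_bound N n m) as [C HC].
destruct (ex_RInt_gen_exp_bound (eta_integrand N n m) C (/ 4)) as [l Hl];
  [lra|exact (eta_integrand_continuous N n m)|exact HC|].
unfold eta; rewrite Gamma_S.
rewrite (RInt_gen_0_oo_unique _ l).
- replace (INR (fact N) * (/ INR (fact N) * l)) with l; [assumption|].
  field; apply INR_fact_neq_0.
- apply is_RInt_gen_0_oo_ext with (2 := Hl); intros t Ht.
  rewrite Rpower_INR_S by assumption.
  unfold eta_integrand, Li; now rewrite rev_app_distr, rev_repeat.
Qed.

(** * The symmetric kernel and its binomial expansion *)

Definition kernel (a b q : nat) (t s : R) : R :=
  / (INR (fact a) * INR (fact b) * INR (fact q))
  * (t ^ a * s ^ b * (t + s - ln (exp s + exp t - 1)) ^ q / (exp s + exp t - 1)).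

Lemma kernel_sym (a b q : nat) (t s : R) : kernel a b q t s = kernel b a q s t.
Proof.
unfold kernel; rewrite (Rplus_comm t s), (Rplus_comm (exp t) (exp s)).
rewrite (Rmult_comm (t ^ a)), (Rmult_comm (INR (fact a))); reflexivity.
Qed.

(** Binomial theorem for [(s - ln E) + t]: the exponent [n] of [s - ln E] becomes the number of 1s
    in the index, and the remaining [t ^ (q - n)] raises the argument of [eta]. *)
Lemma kernel_expand (a b q : nat) (t s : R) :
  kernel a b q t s = sum_f_R0 (fun n =>
     / (INR (fact a) * INR (fact (q - n))) *
     (/ (INR (fact b) * INR (fact n)) * (t ^ (a + q - n) * s ^ b
      * (s - ln (exp s + exp t - 1)) ^ n / (exp s + exp t - 1)))) q.
Proof.
unfold kernel.
replace (t + s - ln (exp s + exp t - 1))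
  with ((s - ln (exp s + exp t - 1)) + t) by ring.
set (x := s - _); set (E := exp s + exp t - 1).
replace (/ _ * _) with (sum_f_R0 (fun i => Binomial.C q i * x ^ i * t ^ (q - i)) q
  * (/ (INR (fact a) * INR (fact b) * INR (fact q)) * (t ^ a * s ^ b / E))).
2: { rewrite <- binomial; unfold Rdiv; ring. }
rewrite Rmult_comm, scal_sum; apply sum_eq; intros n Hn.
replace (a + q - n)%nat with (a + (q - n))%nat by lia.
unfold Binomial.C; rewrite pow_add; unfold Rdiv; rewrite !Rinv_mult.
(* The one cancellation required is that of [q!]; [ring] treats the other inverses as atoms. *)
assert (Hq := Rinv_l (INR (fact q)) (INR_fact_neq_0 q)).
ring [Hq].
Qed.

Lemma continuity_2d_pt_kernel (a b q : nat) (t s : R) :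
  0 < t -> 0 < s -> continuity_2d_pt (kernel a b q) t s.
Proof.
intros Ht Hs; assert (H1 := exp_gt_1 t Ht); assert (H2 := exp_gt_1 s Hs).
assert (Hcont : forall f x, ex_derive f x -> continuity_pt f x).
{ intros f x Hf; now apply continuity_pt_filterlim, (ex_derive_continuous f). }
assert (HE : continuity_2d_pt (fun t s => exp s + exp t - 1) t s).
{ apply continuity_2d_pt_minus; [apply continuity_2d_pt_plus|apply continuity_2d_pt_const].
  - apply (continuity_1d_2d_pt_comp exp (fun _ s => s)); [|apply continuity_2d_pt_id2].
    apply Hcont; auto_derive; trivial.
  - apply (continuity_1d_2d_pt_comp exp (fun t _ => t)); [|apply continuity_2d_pt_id1].
    apply Hcont; auto_derive; trivial. }
assert (Hpow : forall f n, continuity_2d_pt f t s ->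
  continuity_2d_pt (fun t s => f t s ^ n) t s).
{ intros f n; apply (continuity_1d_2d_pt_comp (fun x => x ^ n)).
  apply Hcont; auto_derive; trivial. }
unfold kernel; apply continuity_2d_pt_mult; [apply continuity_2d_pt_const|].
unfold Rdiv; apply continuity_2d_pt_mult;
  [|apply continuity_2d_pt_inv; [assumption|lra]].
apply continuity_2d_pt_mult; [apply continuity_2d_pt_mult|]; apply Hpow.
- apply continuity_2d_pt_id1.
- apply continuity_2d_pt_id2.
- apply continuity_2d_pt_minus.
  + apply continuity_2d_pt_plus; [apply continuity_2d_pt_id1|apply continuity_2d_pt_id2].
  + apply (continuity_1d_2d_pt_comp ln); [|assumption].
    apply Hcont; auto_derive; lra.
Qed.

(** One side of the identity for [p = a + 1], [k = b + 1], [r = q + 1], summed over [n = j - 1]. *)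
Definition eta_sum (a b q : nat) : R :=
  sum_f_R0 (fun n => Binomial.C (a + q - n) a
    * eta (repeat 1%nat n ++ S b :: nil) (INR (S (a + q - n)))) q.

(** The factor [(a + q - n)!] from [Gamma] turns the coefficient [1 / (a! (q - n)!)] of the
    expansion into the binomial coefficient of [eta_sum]. *)
Lemma eta_sum_iterated_integral (a b q : nat) :
  exists g : R -> R,
    (forall t, 0 < t ->
      is_RInt_gen (kernel a b q t) (at_right 0) (Rbar_locally p_infty) (g t)) /\
    is_RInt_gen g (at_right 0) (Rbar_locally p_infty) (eta_sum a b q).
Proof.
exists (fun t => sum_f_R0 (fun n => scal (/ (INR (fact a) * INR (fact (q - n))))
  (eta_integrand (a + q - n) n b t)) q); split.
- intros t Ht.
  apply is_RInt_gen_0_oo_ext with (1 := fun s _ => eq_sym (kernel_expand a b q t s)).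
  apply (is_RInt_gen_sum_f_R0 (fun n s => / (INR (fact a) * INR (fact (q - n))) * _)).
  intros n Hn; apply (is_RInt_gen_scal (V := R_NormedModule)).
  now apply eta_integrand_integral.
- apply (is_RInt_gen_sum_f_R0 (fun n t =>
    scal (/ (INR (fact a) * INR (fact (q - n)))) (eta_integrand (a + q - n) n b t))).
  intros n Hn.
  replace (_ * eta _ _) with (scal (/ (INR (fact a) * INR (fact (q - n))))
    (INR (fact (a + q - n)) * eta (repeat 1%nat n ++ S b :: nil) (INR (S (a + q - n))))).
  + apply (is_RInt_gen_scal (V := R_NormedModule)), is_RInt_gen_eta.
  + unfold Binomial.C; replace (a + q - n - a)%nat with (q - n)%nat by lia.
    unfold scal; simpl; unfold mult, Rdiv; simpl; ring.
Qed.

Lemma eta_sum_sym (a b q : nat) : eta_sum a b q = eta_sum b a q.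
Proof.
destruct (eta_sum_iterated_integral a b q) as (g & Hg & HA).
destruct (eta_sum_iterated_integral b a q) as (h & Hh & HB).
destruct (kernel_bound a b q) as [C HC].
set (K := / (INR (fact a) * INR (fact b) * INR (fact q))).
apply (RInt_gen_fubini (kernel a b q) g h (K * C) (/ 4)); auto.
- lra.
- intros t s; apply continuity_2d_pt_kernel.
- intros t s Ht Hs; unfold kernel; fold K.
  assert (HK : 0 <= K).
  { apply Rlt_le, Rinv_0_lt_compat, Rmult_lt_0_compat;
      [apply Rmult_lt_0_compat|]; apply INR_fact_lt_0. }
  rewrite Rabs_mult, (Rabs_pos_eq K) by assumption.
  rewrite !(Rmult_assoc K); apply Rmult_le_compat_l; [assumption|].
  apply HC; auto.
  (* The upper bound on [ln E] makes [t + s - ln E] nonnegative, and the lower bound [s <= ln E]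
     makes it at most [t]. *)
  assert (B := ln_exp_plus_exp_bounds t s Ht Hs).
  rewrite (Rplus_comm (exp s)).
  assert (B' := ln_exp_plus_exp_bounds s t Hs Ht).
  rewrite Rplus_comm in B; rewrite Rabs_pos_eq; lra.
- intros s Hs; apply is_RInt_gen_0_oo_ext with (2 := Hh s Hs).
  intros t _; apply kernel_sym.
Qed.

Theorem theorem2p20 (p k r : nat)
  (hp : (1 <= p)%nat) (hk : (1 <= k)%nat) (hr : (1 <= r)%nat) :
  sum_n_m (fun j : nat =>
      Binomial.C (p + r - j - 1) (p - 1)
      * eta (repeat 1%nat (j - 1) ++ k :: nil) (INR (p + r - j))) 1 r
  = sum_n_m (fun j : nat =>
      Binomial.C (k + r - j - 1) (k - 1)
      * eta (repeat 1%nat (j - 1) ++ p :: nil) (INR (k + r - j))) 1 r.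
Proof.
destruct p as [|a]; [lia|]; destruct k as [|b]; [lia|]; destruct r as [|q]; [lia|].
assert (H : forall a b, sum_n_m (fun j : nat =>
      Binomial.C (S a + S q - j - 1) (S a - 1)
      * eta (repeat 1%nat (j - 1) ++ S b :: nil) (INR (S a + S q - j))) 1 (S q)
  = eta_sum a b q).
(* The shift is [j = n + 1]; [n <= q] keeps the natural-number subtractions from truncating. *)
{ intros a' b'; rewrite <- sum_n_m_S.
  unfold eta_sum; rewrite <- sum_n_Reals; apply sum_n_ext_loc; intros n Hn.
  replace (S a' + S q - S n - 1)%nat with (a' + q - n)%nat by lia.
  replace (S a' + S q - S n)%nat with (S (a' + q - n)) by lia.
  now rewrite !Nat.sub_succ, !Nat.sub_0_r. }
rewrite !H; apply eta_sum_sym.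
Qed.
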